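(* Let $n\ge 1$, let $\beta_1,\beta_2,\beta_3\in\mathbb{R}$ be parameters, and for $1\le r\le n$ let $$I_r=\beta_1\left(w_2w_4\cdots w_{2n}\,\Theta^{1,2n+1}_{2r-1,0}+\frac{1}{w_2w_4\cdots w_{2n}}\,\Theta^{1,2n+1}_{2r-1,1}\right)+\beta_2\,\Theta^{1,2n+1}_{2r,1}+\beta_3\,\Theta^{1,2n+1}_{2r,0},$$ a function of the nonzero real variables $w_1,\dots,w_{2n}$, where $\Theta=\Theta[e_i]$ has argument $e_1=1$ and $e_i=w_1w_2\cdots w_{i-1}$ for $2\le i\le 2n+1$. Then for all $1\le r,s\le n$, $$\{I_r,I_s\}_w=0.$$
   Context: For integers $a\le b$, $r\ge 0$, and $\epsilon$ an integer (only its residue mod 2 matters), the multi-sum with argument $e_i$ is $$\Theta^{a,b}_{r,\epsilon}[e_i]=\sum_{a\le i_1<i_2<\cdots<i_r\le b}\ \prod_{j=1}^r (e_{i_j})^{(-1)^{j+\epsilon}},$$ with $\Theta^{a,b}_{0,\epsilon}=1$ (and $\Theta^{a,b}_{r,\epsilon}=0$ for $r>b-a+1$). The Poisson bracket of differentiable functions $g,h$ of $w_1,\dots,w_{2n}$ is $\{g,h\}_w=\nabla_w(g)\,\Omega\,(\nabla_w(h))^T$, where $\nabla_w$ is the row gradient and $\Omega$ is the antisymmetric $2n\times 2n$ matrix with $\Omega_{i,i+1}=w_iw_{i+1}$ for $1\le i\le 2n-1$ and $\Omega_{ij}=0$ for $j>i+1$. *)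

(* Defs.v *)
From mathcomp Require Import all_boot all_order all_algebra.
From mathcomp Require Import all_classical all_reals all_analysis.

Set Implicit Arguments.
Unset Strict Implicit.
Unset Printing Implicit Defensive.

Import Order.TTheory GRing.Theory Num.Theory.
Import numFieldNormedType.Exports.

Local Open Scope ring_scope.

(* The multi-sum Theta^{a,b}_{r,eps}[e].  The summation index [i] is the tuple
   i_1 < ... < i_r of integers in [a, b]; since ['I_r] starts at 0, [i j] is
   i_(j+1), whence the exponent (-1)^(j+1+eps). *)
Definition Theta (R : realType) (e : nat -> R) (a b r : nat) (eps : int) : R :=
  \sum_(i : {ffun 'I_r -> 'I_b.+1} |
         [forall j : 'I_r, a <= i j]%N
         && [forall j : 'I_r, forall k : 'I_r, (j < k)%N ==> (i j < i k)%N])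
    \prod_(j < r) e (i j) ^ ((-1) ^ (j.+1%:Z + eps)).

(* Throughout, the variable w_k (1 <= k <= m) is the entry [w 0 i] with
   i = k - 1 as a natural number. *)

Definition grad (R : realType) (m : nat) (g : 'rV[R]_m -> R) (w : 'rV[R]_m) :
    'rV[R]_m :=
  \row_(i < m) derive g w (delta_mx 0 i).

Definition Omega (R : realType) (m : nat) (w : 'rV[R]_m) : 'M[R]_m :=
  \matrix_(i < m, j < m)
    if j == i.+1 :> nat then w 0 i * w 0 j
    else if i == j.+1 :> nat then - (w 0 i * w 0 j)
    else 0.

Definition poisson (R : realType) (m : nat) (g h : 'rV[R]_m -> R)
    (w : 'rV[R]_m) : R :=
  (grad g w *m Omega w *m (grad h w)^T) 0 0.

(* e_i = w_1 w_2 ... w_(i-1), in particular e_1 = 1. *)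
Definition earg (R : realType) (m : nat) (w : 'rV[R]_m) (i : nat) : R :=
  \prod_(k < m | (k.+1 < i)%N) w 0 k.

(* w_2 w_4 ... w_(2n): the even-numbered variables sit at odd positions. *)
Definition evenprod (R : realType) (m : nat) (w : 'rV[R]_m) : R :=
  \prod_(k < m | odd k) w 0 k.

Definition Ifun (R : realType) (n : nat) (b1 b2 b3 : R) (r : nat)
    (w : 'rV[R]_(2 * n)) : R :=
  let T := Theta (earg w) 1 (2 * n + 1) in
  b1 * (evenprod w * T (2 * r - 1)%N 0
        + (evenprod w)^-1 * T (2 * r - 1)%N 1)
  + b2 * T (2 * r)%N 1
  + b3 * T (2 * r)%N 0.

(* Main.v *)
(** With L_i = [[1, l e_i], [l / e_i, 1]], the entries of the monodromy matrix
    T(l) = L_1 ... L_(2n+1) are the generating functions, in l, of the multi-sums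
    Theta, so that up to a constant sum_r l^(2r) I_r is
      F(l) = beta_1 l (P T_21 + T_12 / P) + beta_2 T_11 + beta_3 T_22,
    with P = w_2 w_4 ... w_(2n).  The Poisson structure reads {e_i, e_j} = e_i e_j
    for 2 <= i < j, and {e_i, P} = e_i P for i >= 2, while e_1 = 1 is constant.  By
    induction on the number of factors, the entries t_ab(l) of L_2 ... L_k satisfy
    the quadratic relations of [bform_lax], from which {F(l), F(m)} = 0 for
    l^2 <> m^2 by direct expansion; comparing coefficients gives {I_r, I_s} = 0. *)

Require Import Defs.
From mathcomp Require Import all_boot all_order all_algebra.
From mathcomp Require Import all_classical all_reals all_analysis.
From mathcomp Require Import ring zify.

Set Implicit Arguments.
Unset Strict Implicit.
Unset Printing Implicit Defensive.

Import Order.TTheory GRing.Theory Num.Theory.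
Import numFieldNormedType.Exports.

Local Open Scope ring_scope.

(** * Recursion for the multi-sums *)

Lemma Theta0 (R : realType) (e : nat -> R) (a b : nat) (eps : int) :
  Theta e a b 0 eps = 1.
Proof.
rewrite /Theta (big_pred1 [ffun j : 'I_0 => ord0]) ?big_ord0 // => i /=.
rewrite andbC; apply/andP/eqP => [_|_]; first by apply/ffunP => -[].
by split; apply/forallP => -[].
Qed.

Lemma Theta_empty (R : realType) (e : nat -> R) (r : nat) (eps : int) :
  Theta e 1 0 r.+1 eps = 0.
Proof.
rewrite /Theta big_pred0 // => i; apply/andP => -[/forallP /(_ ord0) + _].
by case: (i ord0) => -[].
Qed.

(** Split the index tuples by whether their largest entry is [b.+1]. If it is, removing it leaves a
    tuple of length [r] in [a, b], and the removed factor carries the exponent of position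
    [r.+1]. *)
Lemma Theta_recr (R : realType) (e : nat -> R) (a b r : nat) (eps : int) :
  (a <= b.+1)%N ->
  Theta e a b.+1 r.+1 eps =
    Theta e a b r.+1 eps
    + Theta e a b r eps * e b.+1 ^ ((-1) ^ (r.+1%:Z + eps)).
Proof.
move=> ab; rewrite /Theta.
rewrite (bigID (fun i : {ffun 'I_r.+1 -> 'I_b.+2} => i ord_max != ord_max)) /=.
congr (_ + _).
- pose w (f : {ffun 'I_r.+1 -> 'I_b.+1}) : {ffun 'I_r.+1 -> 'I_b.+2} :=
    [ffun j => widen_ord (leqnSn b.+1) (f j)].
  pose v (f : {ffun 'I_r.+1 -> 'I_b.+2}) : {ffun 'I_r.+1 -> 'I_b.+1} :=
    [ffun j => inord (f j)].
  rewrite (reindex_onto w v) => [|f /andP[/andP[_ /forallP inc] fm]].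
    apply: eq_big => [f|f _]; last by apply: eq_bigr => j _; rewrite ffunE.
    have -> : v (w f) == f.
      by apply/eqP/ffunP => j; rewrite !ffunE; apply: val_inj; rewrite /= inordK.
    have -> : w f ord_max != ord_max.
      by rewrite ffunE -val_eqE /= neq_ltn ltn_ord.
    rewrite !andbT; congr (_ && _).
      by apply: eq_forallb => j; rewrite ffunE.
    by apply: eq_forallb => j; apply: eq_forallb => k; rewrite !ffunE.
  apply/ffunP => j; rewrite !ffunE; apply: val_inj; rewrite /= inordK //.
  have mb : (f ord_max < b.+1)%N.
    by have := ltn_ord (f ord_max); rewrite ltnS leq_eqVlt -val_eqE in fm *; case: eqP fm.
  have [->//|jm] := eqVneq j ord_max.
  have /forallP/(_ ord_max)/implyP h := inc j.
  apply: ltn_trans mb; apply: h.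
  by rewrite ltn_neqAle -ltnS ltn_ord andbT; move: jm; rewrite -val_eqE.
- pose w (f : {ffun 'I_r -> 'I_b.+1}) : {ffun 'I_r.+1 -> 'I_b.+2} :=
    [ffun j => oapp (fun k => widen_ord (leqnSn b.+1) (f k)) ord_max
                 (unlift ord_max j)].
  pose v (f : {ffun 'I_r.+1 -> 'I_b.+2}) : {ffun 'I_r -> 'I_b.+1} :=
    [ffun j => inord (f (lift ord_max j))].
  have wl f j : w f (lift ord_max j) = widen_ord (leqnSn b.+1) (f j).
    by rewrite ffunE liftK.
  have wm f : w f ord_max = ord_max by rewrite ffunE unlift_none.
  rewrite big_distrl /= (reindex_onto w v) => [|f].
    apply: eq_big => [f|f _]; last first.
      rewrite big_ord_recr /= wm; congr (_ * _); apply: eq_bigr => j _.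
      have -> : widen_ord (leqnSn r) j = lift ord_max j.
        exact/val_inj/esym/lift_max.
      by rewrite wl.
    rewrite wm eqxx andbT.
    have -> : v (w f) == f.
      by apply/eqP/ffunP => j; rewrite ffunE wl; apply: val_inj; rewrite /= inordK.
    rewrite andbT; congr (_ && _).
      apply/forallP/forallP => h j; first by have := h (lift ord_max j); rewrite wl.
      by case: (unliftP ord_max j) => [k ->|->]; rewrite ?wl ?wm //; exact: h.
    apply/forallP/forallP => h j; apply/forallP => k.
      by have /forallP/(_ (lift ord_max k)) := h (lift ord_max j); rewrite !wl !lift_max.
    case: (unliftP ord_max j) => [j' ->|->]; last first.
      by apply/implyP => mk; have := ltn_ord k; rewrite ltnS leqNgt mk.
    case: (unliftP ord_max k) => [k' ->|->].
      by rewrite !wl !lift_max; have /forallP/(_ k') := h j'.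
    by apply/implyP => _; rewrite wl wm /=.
  move=> /andP[/andP[_ /forallP inc]]; rewrite negbK => /eqP fm.
  apply/ffunP => j; case: (unliftP ord_max j) => [k ->|->]; last by rewrite wm.
  rewrite wl; apply: val_inj; rewrite /= ffunE inordK //.
  have /forallP/(_ ord_max)/implyP := inc (lift ord_max k).
  by rewrite fm; apply; rewrite lift_max /=.
Qed.

(** * The bracket as a bilinear form on gradients at a fixed point *)

Definition bform (R : realType) (m : nat) (w u v : 'rV[R]_m) : R :=
  (u *m Omega w *m v^T) 0 0.

Lemma bformDl (R : realType) (m : nat) (w u u' v : 'rV[R]_m) :
  bform w (u + u') v = bform w u v + bform w u' v.
Proof. by rewrite /bform !mulmxDl mxE. Qed.

Lemma bformDr (R : realType) (m : nat) (w u v v' : 'rV[R]_m) :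
  bform w u (v + v') = bform w u v + bform w u v'.
Proof. by rewrite /bform linearD mulmxDr mxE. Qed.

Lemma bformZl (R : realType) (m : nat) (w u v : 'rV[R]_m) (c : R) :
  bform w (c *: u) v = c * bform w u v.
Proof. by rewrite /bform -!scalemxAl mxE. Qed.

Lemma bformZr (R : realType) (m : nat) (w u v : 'rV[R]_m) (c : R) :
  bform w u (c *: v) = c * bform w u v.
Proof. by rewrite /bform linearZ -scalemxAr mxE. Qed.

Lemma bform0l (R : realType) (m : nat) (w v : 'rV[R]_m) : bform w 0 v = 0.
Proof. by rewrite /bform !mul0mx mxE. Qed.

Lemma bform0r (R : realType) (m : nat) (w u : 'rV[R]_m) : bform w u 0 = 0.
Proof. by rewrite /bform trmx0 mulmx0 mxE. Qed.

Definition bformE := (bformDl, bformDr, bformZl, bformZr).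

Lemma bformC (R : realType) (m : nat) (w u v : 'rV[R]_m) :
  bform w u v = - bform w v u.
Proof.
have OmegaN : (Omega w)^T = - Omega w.
  apply/matrixP => i j; rewrite !mxE.
  have [->|ji] := eqVneq (j : nat) i.+1.
    by rewrite -[_ == _.+2]/(_ == _) (ltn_eqF (leqnSn i.+1)) mulrC.
  by case: ifP => _; rewrite ?opprK ?oppr0 // mulrC.
have -> : bform w u v = (u *m Omega w *m v^T)^T 0 0 by rewrite [RHS]mxE.
by rewrite !trmx_mul trmxK OmegaN mulNmx mulmxN mxE mulmxA.
Qed.

Lemma bformxx (R : realType) (m : nat) (w u : 'rV[R]_m) : bform w u u = 0.
Proof. by have /eqP := bformC w u u; rewrite -addr_eq0 -mulr2n mulrn_eq0 /= => /eqP. Qed.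

(** * Brackets between matrix entries at two spectral parameters *)

(* The entry (a, b) of the product of the first k matrices
   [[1, l e_j], [l / e_j, 1]]; [false] stands for the index 1, [true] for 2. *)
Fixpoint lax (R : realType) (e : nat -> R) (l : R) (k : nat) (a b : bool) : R :=
  if k is k'.+1 then
    lax e l k' a b + l * (if b then e k' else (e k')^-1) * lax e l k' a (~~ b)
  else (a == b)%:R.

(* The gradient of [lax] when e_j has gradient e_j g_j (see [hasgrad_lax]). *)
Fixpoint laxg (R : realType) (m : nat) (e : nat -> R) (g : nat -> 'rV[R]_m)
    (l : R) (k : nat) (a b : bool) : 'rV[R]_m :=
  if k is k'.+1 then
    laxg e g l k' a b
    + (l * (if b then e k' else (e k')^-1)) *: laxg e g l k' a (~~ b)
    + ((if b then 1 else -1) * (l * (if b then e k' else (e k')^-1))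
       * lax e l k' a (~~ b)) *: g k'
  else 0.

(* If v is the gradient of log f with {e_j, f} = e_j f for all j < k, then
   bracketing with log f is the commutator with diag(1/2, -1/2). *)
Lemma bform_laxg (R : realType) (m : nat) (w : 'rV[R]_m) (e : nat -> R)
    (g : nat -> 'rV[R]_m) (v : 'rV[R]_m) (l : R) (k : nat) (a b : bool) :
  (forall j, (j < k)%N -> bform w (g j) v = 1) ->
  bform w (laxg e g l k a b) v = (b%:R - a%:R) * lax e l k a b.
Proof.
elim: k b => [|k IH] b gv /=.
  by rewrite bform0l; case: a b => -[] /=; ring.
have gv' j : (j < k)%N -> bform w (g j) v = 1.
  by move=> jk; apply/gv/ltnW.
rewrite !bformE !IH // gv //.
by case: b => /=; ring.
Qed.

(** A new factor multiplies on the right, so [a] and [c] stay fixed in the induction while [b] and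
    [d] vary. Beyond the inductive brackets only those with [g k] appear; every earlier [g j] has
    bracket 1 with it, so [bform_laxg] evaluates them, and a rational identity remains for each
    choice of indices. *)
Lemma bform_lax (R : realType) (m : nat) (w : 'rV[R]_m) (e : nat -> R)
    (g : nat -> 'rV[R]_m) (l x : R) (k : nat) (a b c d : bool) :
  x ^+ 2 - l ^+ 2 != 0 ->
  (forall j, (j < k)%N -> e j != 0) ->
  (forall i j, (i < j < k)%N -> bform w (g i) (g j) = 1) ->
  bform w (laxg e g l k a b) (laxg e g x k c d) =
  (l * x * ((b != d)%:R * lax e l k a d * lax e x k c b
            - (a != c)%:R * lax e l k c b * lax e x k a d)
   + ((a != c)%:R - (b != d)%:R) * (if a == b then l ^+ 2 else x ^+ 2)
     * lax e l k a b * lax e x k c d) / (x ^+ 2 - l ^+ 2).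
Proof.
move=> xl; elim: k b d => [|k IH] b d e0 gg /=.
  by rewrite bform0l; case: a b c d => -[] [] [] /=; ring.
have {}IH b' d' := IH b' d' (fun j jk => e0 j (ltnW jk)) _.
have gg' i j : (i < j < k)%N -> bform w (g i) (g j) = 1.
  by move=> /andP[ij jk]; apply: gg; rewrite ij ltnW.
have gk j : (j < k)%N -> bform w (g j) (g k) = 1.
  by move=> jk; apply: gg; rewrite jk ltnSn.
have ek := e0 k (ltnSn k).
rewrite !bformE bformxx ![bform w (g k) _]bformC !IH // !bform_laxg //.
move: ek {IH gg gg' gk e0}; move: (e k) => z z0.
move: (lax e l k) (lax e x k) => t s.
by case: a b c d => -[] [] [] /=; field; rewrite ?xl ?z0.
Qed.

(** * Calculus of gradients *)

(** Existence of the partial derivatives is carried along with their values, since [derive] alone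
    returns a value even where the limit fails to exist. *)
Definition hasgrad (R : realType) (m : nat) (f : 'rV[R]_m -> R)
    (w u : 'rV[R]_m) : Prop :=
  forall k, is_derive w (delta_mx 0 k) f (u 0 k).

Lemma hasgrad_grad (R : realType) (m : nat) (f : 'rV[R]_m -> R) (w u : 'rV[R]_m) :
  hasgrad f w u -> grad f w = u.
Proof.
by move=> fu; apply/rowP => k; rewrite mxE; have := fu k => /@derive_val.
Qed.

Lemma hasgrad_cst (R : realType) (m : nat) (c : R) (w : 'rV[R]_m) :
  hasgrad (fun=> c) w 0.
Proof. by move=> k; rewrite mxE; exact: is_derive_cst. Qed.

Lemma hasgradD (R : realType) (m : nat) (f g : 'rV[R]_m -> R) (w u v : 'rV[R]_m) :
  hasgrad f w u -> hasgrad g w v -> hasgrad (fun x => f x + g x) w (u + v).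
Proof. by move=> fu gv k; rewrite mxE; exact: is_deriveD. Qed.

Lemma hasgradM (R : realType) (m : nat) (f g : 'rV[R]_m -> R) (w u v : 'rV[R]_m) :
  hasgrad f w u -> hasgrad g w v ->
  hasgrad (fun x => f x * g x) w (f w *: v + g w *: u).
Proof. by move=> fu gv k; rewrite !mxE; exact: is_deriveM. Qed.

Lemma hasgradZ (R : realType) (m : nat) (c : R) (f : 'rV[R]_m -> R) (w u : 'rV[R]_m) :
  hasgrad f w u -> hasgrad (fun x => c * f x) w (c *: u).
Proof. by move=> fu k; rewrite mxE; exact: is_deriveZ. Qed.

Lemma hasgradV (R : realType) (m : nat) (f : 'rV[R]_m -> R) (w u : 'rV[R]_m) :
  f w != 0 -> hasgrad f w u ->
  hasgrad (fun x => (f x)^-1) w (- (f w) ^- 2 *: u).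
Proof.
move=> f0 fu k; have fk := fu k.
have df : derivable f w (delta_mx 0 k) by exact: ex_derive.
by rewrite mxE; apply: DeriveDef; [exact: derivableV|rewrite deriveV // derive_val].
Qed.

Lemma hasgrad_sum (R : realType) (m K : nat) (f : nat -> 'rV[R]_m -> R)
    (w : 'rV[R]_m) (u : nat -> 'rV[R]_m) :
  (forall r, hasgrad (f r) w (u r)) ->
  hasgrad (fun x => \sum_(r < K) f r x) w (\sum_(r < K) u r).
Proof.
move=> fu; elim: K => [|K IH].
  rewrite big_ord0; under eq_fun do rewrite big_ord0; exact: hasgrad_cst.
by rewrite big_ord_recr; under eq_fun do rewrite big_ord_recr; exact: hasgradD.
Qed.

Lemma hasgrad_coord (R : realType) (m : nat) (w : 'rV[R]_m) (j : 'I_m) :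
  hasgrad (fun x => x 0 j) w (delta_mx 0 j).
Proof.
move=> k; set d := delta_mx 0 j 0 k.
have dE : d = (delta_mx 0 k : 'rV[R]_m) 0 j by rewrite /d !mxE [k == j]eq_sym.
(* The difference quotient of a coordinate is constant for h <> 0. *)
have quot : ((fun h : R => h^-1 *: (((fun x : 'rV[R]_m => x 0 j) \o shift w)
    (h *: delta_mx 0 k) - w 0 j)) @ 0^' --> d)%classic.
  apply: cvg_near_cst; near=> h.
  have h0 : h != 0 by near: h; exact: nbhs_dnbhs_neq.
  rewrite /= dE !mxE addrK.
  by rewrite [_ *: _]mulKf.
by apply: DeriveDef; [apply/cvg_ex; exists d|exact: cvg_lim quot].
Unshelve. all: by end_near. Qed.

(** * Products of variables and their logarithmic gradients *)

Definition subprod (R : realType) (m : nat) (Q : pred nat) (w : 'rV[R]_m) : R :=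
  \prod_(k < m | Q k) w 0 k.

Definition loggrad (R : realType) (m : nat) (Q : pred nat) (w : 'rV[R]_m) :
    'rV[R]_m :=
  \row_(k < m) if Q k then (w 0 k)^-1 else 0.

Lemma subprod_neq0 (R : realType) (m : nat) (Q : pred nat) (w : 'rV[R]_m) :
  (forall k, w 0 k != 0) -> subprod Q w != 0.
Proof. by move=> w0; apply/prodf_neq0. Qed.

Lemma hasgrad_subprod (R : realType) (m : nat) (Q : pred nat) (w : 'rV[R]_m) :
  (forall k, w 0 k != 0) ->
  hasgrad (subprod Q) w (subprod Q w *: loggrad Q w).
Proof.
move=> w0.
have -> : loggrad Q w = \sum_(k < m | Q k) (w 0 k)^-1 *: delta_mx 0 k.
  rewrite [LHS]row_sum_delta [RHS]big_mkcond; apply: eq_bigr => k _.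
  by rewrite mxE; case: ifP => // _; rewrite scale0r.
rewrite /subprod; elim: (index_enum _) => [|k s IH].
  under eq_fun do rewrite big_nil.
  rewrite !big_nil scaler0; exact: hasgrad_cst.
under eq_fun do rewrite big_cons.
rewrite !big_cons; case: ifP => // _.
have := hasgradM (hasgrad_coord w k) IH.
congr hasgrad; rewrite scalerDr !scalerA addrC; congr (_ *: _ + _).
by rewrite mulrAC divff ?mul1r.
Qed.

Lemma sum_ord_delta (R : realType) (m j : nat) (h : nat -> R) :
  \sum_(l < m) (l == j :> nat)%:R * h l = (j < m)%:R * h j.
Proof.
have [jm|mj] := ltnP j m.
  rewrite (bigD1 (Ordinal jm)) //= eqxx big1 ?addr0 // => l.
  by rewrite -val_eqE /= => /negPf ->; rewrite mul0r.
rewrite mul0r big1 // => l _.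
by rewrite (ltn_eqF (leq_trans (ltn_ord l) mj)) mul0r.
Qed.

(** In logarithmic coordinates [Omega] has constant entries 1 and -1 beside the diagonal, so row k
    contributes [k+1 in Q] - [k-1 in Q]. By hypothesis only row 0 survives. This one criterion
    covers both {e_i, e_j} = e_i e_j and {e_i, P} = e_i P. *)
Lemma bform_loggrad (R : realType) (m p : nat) (Q : pred nat) (w : 'rV[R]_m) :
  (forall k, w 0 k != 0) -> (p < m)%N ->
  (forall k, (k <= p)%N ->
     ((k.+1 < m)%N && Q k.+1)%:R - ((0 < k)%N && Q k.-1)%:R = (k == 0)%:R :> R) ->
  bform w (loggrad (fun k => (k.+1 < p.+2)%N) w) (loggrad Q w) = 1.
Proof.
move=> w0 pm hQ; rewrite /bform -mulmxA mxE.
transitivity (\sum_(k < m) (k == 0 :> nat)%:R * 1 : R); last first.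
  by rewrite (sum_ord_delta m 0 (fun=> 1)) mulr1 (leq_ltn_trans _ pm).
apply: eq_bigr => k _; rewrite mulr1 !mxE ltnS.
case: ifP => [kp|kp]; last first.
  by rewrite mul0r; case: (k : nat) kp.
rewrite -hQ // mulr_sumr.
(* At k = 0 the index [k.-1] is again 0; the guard [0 < k] removes this false left neighbour. *)
transitivity (\sum_(l < m) ((l == k.+1 :> nat)%:R * (Q l)%:R
    - (l == k.-1 :> nat)%:R * ((0 < k)%N && Q l)%:R) : R).
  apply: eq_bigr => l _; rewrite !mxE.
  have wk := w0 k; have wl := w0 l.
  have [->|lk] := eqVneq (l : nat) k.+1.
    have -> : (k.+1 == k.-1) = false by rewrite gtn_eqF // ltnS leq_pred.
    by rewrite ?eqxx; case: (Q k.+1); rewrite ?mul0r ?mulr0 ?subr0 ?mul1r //=;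
      field; rewrite wk wl.
  have [->|kl] := eqVneq (k : nat) l.+1.
    by rewrite eqxx /=; case: (Q l); rewrite ?mul0r ?mulr0 ?subr0 ?sub0r ?oppr0 ?mul1r //=;
      field; rewrite wk wl.
  rewrite mul0r mulr0 mul0r sub0r; case: eqP => [e|_]; last by rewrite mul0r oppr0.
  have [k0|k0] := posnP k; first by rewrite mulr0 oppr0.
  by move: kl; rewrite e prednK // eqxx.
rewrite big_split /= sumrN (sum_ord_delta m k.+1 (fun l => (Q l)%:R)).
rewrite (sum_ord_delta m k.-1 (fun l => ((0 < k)%N && Q l)%:R)).
rewrite (leq_ltn_trans (leq_pred k) (ltn_ord k)) mul1r.
by case: ltnP; rewrite ?mul1r ?mul0r.
Qed.

(** * Matrix entries as generating functions of the multi-sums *)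

(* The entry (a, b) of L_1 ... L_N, truncated at K terms: the parity of the
   multi-sums is that of [a != b], and eps = 1 iff a is the index 1. *)
Definition theta_series (R : realType) (e : nat -> R) (l : R) (N K : nat)
    (a b : bool) : R :=
  \sum_(r < K) l ^+ (2 * r + (a != b))
    * Theta e 1 N (2 * r + (a != b)) (~~ a)%:Z.

Lemma Theta_gt (R : realType) (e : nat -> R) (N r : nat) (eps : int) :
  (N < r)%N -> Theta e 1 N r eps = 0.
Proof.
elim: N r => [|N IH] [|r] // Nr; first exact: Theta_empty.
by rewrite Theta_recr // !IH ?mul0r ?addr0 // ltnW.
Qed.

Lemma theta_series0 (R : realType) (e : nat -> R) (l : R) (K : nat) (a b : bool) :
  theta_series e l 0 K.+1 a b = (a == b)%:R.
Proof.
rewrite /theta_series big_ord_recl big1 => [|r _]; last first.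
  by rewrite Theta_gt ?mulr0 // lift0 mulnS.
by case: (a == b); rewrite /= ?Theta0 ?Theta_gt // ?mulr1 ?mulr0 addr0.
Qed.

Lemma theta_seriesS (R : realType) (e : nat -> R) (l : R) (N K : nat) (a b : bool) :
  (N <= K.*2)%N ->
  theta_series e l N.+1 K.+1 a b =
    theta_series e l N K.+1 a b
    + l * (if b then e N.+1 else (e N.+1)^-1) * theta_series e l N K.+1 a (~~ b).
Proof.
move=> NK; set z := if b then _ else _.
(* The exponent of the last factor depends only on the parity of [r]; once that parity is fixed by
   [a] and [b], the exponent depends on [b] alone. *)
have zE r : odd r = (a (+) b) ->
    e N.+1 ^ ((-1) ^ (r%:Z + (~~ a)%:Z)) = z.
  move=> ro; have -> : (-1) ^ (r%:Z + (~~ a)%:Z) = ((-1) ^+ (~~ b) : int).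
    rewrite -PoszD -exprnP -[LHS]signr_odd oddD ro oddb.
    by case: a b {z ro} => -[].
  by rewrite /z; case: b {ro z} => /=; rewrite ?expr1z // exprN1.
rewrite /theta_series; case: (eqVneq a b) => [ab|ab] /=.
- have -> : (a == ~~ b) = false by rewrite ab; case: b {z zE ab}.
  rewrite [LHS]big_ord_recl [in RHS]big_ord_recl !Theta0 -addrA; congr (_ + _).
  (* For a = b the odd series on the right has one term too many, of degree 2K+1 > N, and its
     multi-sum vanishes. *)
  rewrite [X in l * z * X]big_ord_recr /= (Theta_gt e (r := (2 * K + 1)%N)); last first.
    by rewrite addn1 ltnS mul2n.
  rewrite mulr0 addr0 mulr_sumr -big_split; apply: eq_bigr => r _.
  rewrite /bump /= add1n !addn0 mulnS add2n Theta_recr // zE; last first.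
    by rewrite /= mul2n odd_double ab addbb.
  by rewrite !addn1 exprS; ring.
- have -> : (a == ~~ b) by case: a b ab {z zE} => -[].
  rewrite mulr_sumr -big_split; apply: eq_bigr => r _.
  rewrite addn1 addn0 Theta_recr // zE; last first.
    by rewrite /= mul2n odd_double; case: a b ab {z zE} => -[].
  rewrite /=; by rewrite exprS; ring.
Qed.

(* The factor L_1 = [[1, l], [l, 1]] (as e_1 = 1) is kept apart from [lax]: e_1 has
   zero bracket with everything, unlike the other e_i. *)
Lemma theta_series_lax (R : realType) (e : nat -> R) (l : R) (k K : nat)
    (a b : bool) :
  e 1 = 1 -> (k <= K.*2)%N ->
  theta_series e l k.+1 K.+1 a b =
    lax (fun j => e j.+2) l k a b + l * lax (fun j => e j.+2) l k (~~ a) b.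
Proof.
move=> e1; elim: k b => [|k IH] b kK.
  rewrite theta_seriesS // !theta_series0 e1 invr1.
  by case: a b => -[] /=; ring.
rewrite theta_seriesS // !IH /=; try exact: ltnW.
by ring.
Qed.

Lemma hasgrad_lax (R : realType) (m : nat) (e : nat -> 'rV[R]_m -> R)
    (g : nat -> 'rV[R]_m) (l : R) (w : 'rV[R]_m) (k : nat) (a b : bool) :
  (forall j, e j w != 0) -> (forall j, hasgrad (e j) w (e j w *: g j)) ->
  hasgrad (fun x => lax (e^~ x) l k a b) w (laxg (e^~ w) g l k a b).
Proof.
move=> e0 eg; elim: k b => [|k IH] b; first exact: hasgrad_cst.
have zg : hasgrad (fun x => l * (if b then e k x else (e k x)^-1)) w
    ((if b then 1 else -1) * (l * (if b then e k w else (e k w)^-1)) *: g k).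
  have := hasgradZ l (eg k); have := hasgradZ l (hasgradV (e0 k) (eg k)).
  case: b => [_|+ _]; congr hasgrad; rewrite !scalerA ?mul1r //.
  by congr (_ *: _); have := e0 k => ek; field.
have := hasgradD (IH b) (hasgradM zg (IH (~~ b))).
by congr hasgrad; rewrite /= !scalerA addrA; congr (_ + _ *: _); ring.
Qed.

(** * Extraction of coefficients and existence of gradients *)

(** Substitute square roots for x and y. For fixed y >= 0 the sum becomes a polynomial in x
    vanishing for all x > y, hence zero; each of its coefficients is then a polynomial in y
    vanishing for all y > 0. *)
Lemma poly2_eq0 (R : realType) (K : nat) (c : nat -> nat -> R) :
  (forall x y : R, x ^+ 2 - y ^+ 2 != 0 ->
    \sum_(r < K) \sum_(s < K) x ^+ (2 * r) * y ^+ (2 * s) * c r s = 0) ->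
  forall r s, (r < K)%N -> (s < K)%N -> c r s = 0.
Proof.
have poly0 (p : {poly R}) (y : R) :
    (forall x : R, 0 <= x -> y < x -> p.[x] = 0) -> p = 0.
  (* The points |y|+1, |y|+2, ... give [size p] distinct roots, more than the degree allows. *)
  move=> p0; pose rs := [seq `|y| + i.+1%:R | i <- iota 0 (size p)].
  apply: (@roots_geq_poly_eq0 _ p rs); last by rewrite size_map size_iota.
    apply/allP => _ /mapP[i _ ->]; apply/rootP/p0; first by rewrite addr_ge0.
    by rewrite (le_lt_trans (ler_norm y)) // ltrDl ltr0Sn.
  rewrite map_inj_uniq ?iota_uniq // => i j /addrI /eqP.
  by rewrite eqr_nat eqSS => /eqP.
move=> hc r s rK sK.
have row0 (y : R) : 0 <= y -> \sum_(s < K) y ^+ s * c r s = 0.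
  move=> y0; pose p := \poly_(r < K) (\sum_(s < K) y ^+ s * c r s).
  suff p0 : p = 0.
    by have := congr1 (fun q : {poly R} => q`_r) p0; rewrite coef_poly rK coef0.
  apply: (poly0 p y) => x x0 yx; rewrite horner_poly.
  have := hc (Num.sqrt x) (Num.sqrt y); rewrite !sqr_sqrtr // subr_eq0 gt_eqF //.
  move=> /(_ isT) h; rewrite -[RHS]h.
  apply: eq_bigr => i _; rewrite mulr_suml; apply: eq_bigr => j _.
  by rewrite !exprM !sqr_sqrtr //; ring.
pose q := \poly_(s < K) c r s.
suff q0 : q = 0.
  by have := congr1 (fun q : {poly R} => q`_s) q0; rewrite coef_poly sK coef0.
apply: (poly0 q 0) => y y0 _; rewrite horner_poly -[RHS](row0 y) //.
by apply: eq_bigr => i _; rewrite mulrC.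
Qed.

(** Existence suffices to differentiate the generating function termwise; the explicit gradient is
    computed on the matrix side. *)
Lemma hasgrad_Theta (R : realType) (m : nat) (e : nat -> 'rV[R]_m -> R)
    (w : 'rV[R]_m) (N r : nat) (eps : int) :
  (forall i, e i w != 0) -> (forall i, exists u, hasgrad (e i) w u) ->
  exists u, hasgrad (fun x => Theta (e^~ x) 1 N r eps) w u.
Proof.
move=> e0 eg; elim: N r => [|N IH] [|r].
- by exists 0; under eq_fun do rewrite Theta0; exact: hasgrad_cst.
- by exists 0; under eq_fun do rewrite Theta_empty; exact: hasgrad_cst.
- by exists 0; under eq_fun do rewrite Theta0; exact: hasgrad_cst.
have [u ug] := IH r.+1; have [v vg] := IH r; have [g gg] := eg N.+1.
have : exists h, hasgrad (fun x => e N.+1 x ^ ((-1) ^ (r.+1%:Z + eps))) w h.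
  have /orP[/eqP ->|/eqP ->] : ((-1) ^ (r.+1%:Z + eps) == 1 :> int)
      || ((-1) ^ (r.+1%:Z + eps) == -1 :> int).
    case: (r.+1%:Z + eps) => p; rewrite ?NegzE -?exprnN -?exprnP -signr_odd;
      by case: odd.
  - by exists g; under eq_fun do rewrite expr1z.
  - by eexists; under eq_fun do rewrite exprN1; exact: hasgradV.
move=> [h hg]; eexists; under eq_fun do rewrite Theta_recr //.
by apply: hasgradD ug _; exact: hasgradM vg hg.
Qed.

(** * The generating function of the I_r and its involutivity *)

(** This is F(l) with [t] the product of all factors but L_1: [t a b + l * t (~~ a) b] is the entry
    (a, b) of L_1 t. *)
Definition genfun (R : realType) (b1 b2 b3 l P : R) (t : bool -> bool -> R) : R :=
  b1 * l * (P * (t true false + l * t false false)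
            + P^-1 * (t false true + l * t true true))
  + b2 * (t false false + l * t true false)
  + b3 * (t true true + l * t false true).

Lemma genfun_Ifun (R : realType) (n : nat) (b1 b2 b3 l : R) (w : 'rV[R]_(2 * n)) :
  genfun b1 b2 b3 l (evenprod w) (lax (fun j => earg w j.+2) l (2 * n)) =
  \sum_(r < n.+3) l ^+ (2 * r)
    * (if r : nat is r'.+1 then Ifun b1 b2 b3 r w else b2 + b3).
Proof.
have e1 : earg w 1 = 1 by rewrite /earg big_pred0.
have T K a b : (n <= K)%N ->
    lax (fun j => earg w j.+2) l (2 * n) a b
      + l * lax (fun j => earg w j.+2) l (2 * n) (~~ a) b =
    theta_series (earg w) l (2 * n + 1) K.+1 a b.
  by move=> nK; rewrite addn1 theta_series_lax // mul2n leq_double.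
(* Off-diagonal entries are odd in l and get a further factor l, so their terms start at l^2. They
   are cut one term shorter, to match the diagonal series once its constant term is split off. *)
rewrite /genfun (T n.+1 true false) // (T n.+1 false true) //.
rewrite (T n.+2 false false) ?(leq_trans (leqnSn _) (leqnSn _)) //.
rewrite (T n.+2 true true) ?(leq_trans (leqnSn _) (leqnSn _)) //.
rewrite /theta_series /= [in b2 * _]big_ord_recl [in b3 * _]big_ord_recl.
rewrite [RHS]big_ord_recl /=.
rewrite muln0 addn0 expr0 !Theta0 !mul1r.
have shift3 (A B C : R) : 
    A + b2 * (1 + B) + b3 * (1 + C) = b2 + b3 + (A + b2 * B + b3 * C).
  by ring.
rewrite shift3; congr (_ + _).
rewrite !(mulrDr, mulr_sumr) -!big_split /=; apply: eq_bigr => r _.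
rewrite /Ifun /bump /= add1n !addn0 mulnS !addn1 add2n subn1 /=.
by rewrite !exprS; ring.
Qed.

(* [dgen l] is the gradient of [genfun] when P has gradient P p
   (see [hasgrad_genfun]). *)
Lemma genfun_bracket (R : realType) (m : nat) (w p : 'rV[R]_m)
    (b1 b2 b3 l x P : R) (e : nat -> R) (g : nat -> 'rV[R]_m) (k : nat) :
  x ^+ 2 - l ^+ 2 != 0 -> P != 0 ->
  (forall j, (j < k)%N -> e j != 0) ->
  (forall i j, (i < j < k)%N -> bform w (g i) (g j) = 1) ->
  (forall j, (j < k)%N -> bform w (g j) p = 1) ->
  let dgen l := let t := lax e l k in let u := laxg e g l k in
    (b2 + b1 * l ^+ 2 * P) *: u false false + (b1 * l * P + b2 * l) *: u true false
    + (b1 * l / P + b3 * l) *: u false true + (b1 * l ^+ 2 / P + b3) *: u true true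
    + (b1 * l * (P * (t true false + l * t false false)
                 - P^-1 * (t false true + l * t true true))) *: p in
  bform w (dgen l) (dgen x) = 0.
Proof.
move=> xl P0 e0 gg gp dgen; rewrite /dgen /= !bformE bformxx ![bform w p _]bformC.
rewrite !bform_lax // !bform_laxg //=.
(* What remains is an identity for arbitrary 2 x 2 matrices [t] and [s]. *)
move: (lax e l k) (lax e x k) => t s.
by field; rewrite xl P0.
Qed.

Lemma hasgrad_genfun (R : realType) (m : nat) (w p : 'rV[R]_m) (b1 b2 b3 l : R)
    (P : 'rV[R]_m -> R) (t : bool -> bool -> 'rV[R]_m -> R)
    (u : bool -> bool -> 'rV[R]_m) :
  P w != 0 -> hasgrad P w (P w *: p) -> (forall a b, hasgrad (t a b) w (u a b)) ->
  hasgrad (fun y => genfun b1 b2 b3 l (P y) (fun a b => t a b y)) w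
    ((b2 + b1 * l ^+ 2 * P w) *: u false false
     + (b1 * l * P w + b2 * l) *: u true false
     + (b1 * l / P w + b3 * l) *: u false true
     + (b1 * l ^+ 2 / P w + b3) *: u true true
     + (b1 * l * (P w * (t true false w + l * t false false w)
                  - (P w)^-1 * (t false true w + l * t true true w))) *: p).
Proof.
move=> P0 gP gt.
have gtt a b c d := hasgradD (gt a b) (hasgradZ l (gt c d)).
have gD := hasgradD (hasgradM gP (gtt true false false false))
                    (hasgradM (hasgradV P0 gP) (gtt false true true true)).
have := hasgradD (hasgradD (hasgradZ (b1 * l) gD)
                           (hasgradZ b2 (gtt false false true false)))
                 (hasgradZ b3 (gtt true true false true)).
congr hasgrad; apply/rowP => i; rewrite !mxE; by field.
Qed.

Lemma hasgrad_Ifun (R : realType) (n : nat) (b1 b2 b3 : R) (r : nat)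
    (w : 'rV[R]_(2 * n)) :
  (forall k, w 0 k != 0) -> exists u, hasgrad (Ifun b1 b2 b3 r) w u.
Proof.
move=> w0.
have T s eps : exists u, hasgrad (fun y : 'rV[R]_(2 * n) =>
    Theta (earg y) 1 (2 * n + 1) s eps) w u.
  apply: (@hasgrad_Theta _ _ (fun i y => earg y i)) => i.
    exact: (subprod_neq0 (fun k => (k.+1 < i)%N) w0).
  by eexists; exact: (hasgrad_subprod (fun k => (k.+1 < i)%N) w0).
have P0 : evenprod w != 0 := subprod_neq0 odd w0.
have gP : hasgrad (@evenprod R (2 * n)) w _ := hasgrad_subprod odd w0.
have [u1 g1] := T (2 * r - 1)%N 0; have [u2 g2] := T (2 * r - 1)%N 1.
have [u3 g3] := T (2 * r)%N 1; have [u4 g4] := T (2 * r)%N 0.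
eexists; exact: hasgradD (hasgradD (hasgradZ b1 (hasgradD (hasgradM gP g1)
  (hasgradM (hasgradV P0 gP) g2))) (hasgradZ b2 g3)) (hasgradZ b3 g4).
Qed.

Theorem theorem10 (R : realType) (n : nat) (hn : (1 <= n)%N)
    (b1 b2 b3 : R) (r s : nat)
    (hr : (1 <= r <= n)%N) (hs : (1 <= s <= n)%N)
    (w : 'rV[R]_(2 * n)) (hw : forall k, w 0 k != 0) :
  poisson (@Ifun R n b1 b2 b3 r) (@Ifun R n b1 b2 b3 s) w = 0.
Proof.
(* [G r] is the coefficient of l^(2r) in the generating function; for r = 0 it is the constant b2 +
   b3. *)
pose G r (y : 'rV[R]_(2 * n)) := if r is r'.+1 then Ifun b1 b2 b3 r y else b2 + b3.
have gG q : hasgrad (G q) w (grad (G q) w).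
  have [u gu] : exists u, hasgrad (G q) w u.
    case: q => [|q]; last exact: hasgrad_Ifun.
    by exists 0; exact: hasgrad_cst.
  by rewrite (hasgrad_grad gu).
pose c i j := bform w (grad (G i) w) (grad (G j) w).
suff c0 : forall i j, (i < n.+3)%N -> (j < n.+3)%N -> c i j = 0.
  case: r s hr hs => [|r] [|s] //= hr hs; apply: (c0 r.+1 s.+1).
    by rewrite !ltnS (leq_trans (ltnW hr)) // ltnW.
  by rewrite !ltnS (leq_trans (ltnW hs)) // ltnW.
apply: poly2_eq0 => x y xy.
pose gen l (v : 'rV[R]_(2 * n)) :=
  genfun b1 b2 b3 l (evenprod v) (lax (fun j => earg v j.+2) l (2 * n)).
have sumG l : hasgrad (gen l) w (\sum_(i < n.+3) l ^+ (2 * i) *: grad (G i) w).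
  have -> : gen l = fun v => \sum_(i < n.+3) l ^+ (2 * i) * G i v.
    by apply/funext => v; rewrite /gen genfun_Ifun.
  apply: (@hasgrad_sum _ _ _ (fun i v => l ^+ (2 * i) * G i v) _
    (fun i => l ^+ (2 * i) *: grad (G i) w)) => i; exact: hasgradZ.
(* By bilinearity the double series of the brackets is the bracket of the generating functions at x
   and y. *)
have -> : \sum_(i < n.+3) \sum_(j < n.+3) x ^+ (2 * i) * y ^+ (2 * j) * c i j =
    bform w (grad (gen x) w) (grad (gen y) w).
  rewrite !(hasgrad_grad (sumG _)).
  rewrite (big_morph (fun u => bform w u _) (fun u v => bformDl w u v _) (bform0l w _)).
  apply: eq_bigr => i _.
  rewrite (big_morph _ (bformDr w _) (bform0r w _)).
  by apply: eq_bigr => j _; rewrite bformZl bformZr mulrA.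
pose g j : 'rV[R]_(2 * n) := loggrad (fun k => (k.+1 < j.+2)%N) w.
have gg j : hasgrad (fun v : 'rV[R]_(2 * n) => earg v j.+2) w (earg w j.+2 *: g j).
  exact: (hasgrad_subprod (fun k => (k.+1 < j.+2)%N) hw).
have e0 j : earg w j.+2 != 0 := subprod_neq0 (fun k => (k.+1 < j.+2)%N) hw.
have P0 : evenprod w != 0 := subprod_neq0 odd hw.
have ggen l := hasgrad_grad (hasgrad_genfun b1 b2 b3 l P0
  (hasgrad_subprod odd hw : hasgrad (@evenprod _ _) _ _)
  (fun a b => hasgrad_lax l (2 * n) a b e0 gg)).
rewrite [X in bform w X]ggen [X in bform w _ X]ggen; apply: genfun_bracket => //.
- by rewrite -oppr_eq0 opprB.
- move=> i j /andP[ij jn]; apply: bform_loggrad => // [|k ki].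
    exact: ltn_trans ij jn.
  (* For 0 < k <= i < j both neighbours of k lie in the range of e_(j+2), so they cancel; k = 0 has
     only the right one. *)
  have -> : (k.+1 < 2 * n)%N && (k.+2 < j.+2)%N by lia.
  have -> : (0 < k)%N && (k.-1.+1 < j.+2)%N = (0 < k)%N by lia.
  by case: k {ki} => [|k] /=; rewrite ?subr0 ?subrr.
- move=> j jn; apply: bform_loggrad => // k kj.
  (* The neighbours of k have equal parity and cancel for k > 0. If k is even then k+1 stays below
     2n because 2n is even. *)
  have -> : (k.+1 < 2 * n)%N && odd k.+1 = ~~ odd k by lia.
  have -> : (0 < k)%N && odd k.-1 = (0 < k)%N && ~~ odd k by lia.
  by case: k {kj} => [|k] /=; rewrite ?subr0 ?subrr.
Qed.
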